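(* Let $n\ge 1$ and consider the planar polynomial system of degree $n$ with real coefficients $$\dot x=\sum_{i,j=0}^{n}a_{i,j}x^iy^j,\qquad \dot y=\sum_{i,j=0}^{n}b_{i,j}x^iy^j,$$ with $a_{0,0}=b_{0,0}=0$ and $a_{i,j}=b_{i,j}=0$ whenever $i+j>n$. (1) There exist infinitely many invariant straight lines $y=mx$ of the system if, for all $k=1,2,\dots,n$, $$b_{k,0}=a_{0,k}=0\quad\text{and}\quad b_{k-j,j}-a_{k-(j-1),j-1}=0\ \text{ for } 1\le j\le k.$$ (2) Let $1\le l\le n$ and let $i_1,\dots,i_l$ be any distinct elements of $\{1,2,\dots,n\}$. Suppose that $$b_{k,0}=a_{0,k}=b_{k-j,j}-a_{k-(j-1),j-1}=0$$ for all $k\in\{1,2,\dots,n\}\setminus\{i_1,\dots,i_l\}$ and all $1\le j\le k$. Then every real number $m$ satisfying the system of $l$ equations $$b_{i_p,0}+\sum_{j=1}^{i_p}\left(b_{i_p-j,j}-a_{i_p-(j-1),j-1}\right)m^j-a_{0,i_p}m^{i_p+1}=0,\qquad 1\le p\le l,$$ gives an invariant line $y=mx$ of the system.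
   Context: A set $S\subseteq\mathbb{R}^2$ is invariant under the flow $\Phi_t$ of a planar system if $\Phi_t(X_0)\in S$ for every $X_0\in S$ and every $t$ in the maximal interval of existence $I(X_0)$ of the solution with initial value $X_0$. A line is called an invariant line of the system if it is an invariant set. *)

(* Defs.v *)
From HB Require Import structures.
From mathcomp Require Import all_boot all_order all_algebra.
From mathcomp Require Import all_classical all_reals all_analysis.
Set Implicit Arguments.
Unset Strict Implicit.
Unset Printing Implicit Defensive.
Import Order.TTheory GRing.Theory Num.Theory.
Import numFieldNormedType.Exports.
Local Open Scope classical_set_scope.
Local Open Scope ring_scope.

Definition poly2 (R : realType) (n : nat) (c : nat -> nat -> R) (x y : R) : R :=
  \sum_(i < n.+1) \sum_(j < n.+1) c i j * x ^+ i * y ^+ j.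

Definition poly_field (R : realType) (n : nat) (a b : nat -> nat -> R)
    (X : R * R) : R * R :=
  (poly2 n a X.1 X.2, poly2 n b X.1 X.2).

(* The values of phi outside J are irrelevant. *)
Definition is_solution (R : realType) (F : R * R -> R * R) (X0 : R * R)
    (J : set R) (phi : R -> R * R) : Prop :=
  [/\ is_interval J, open J, J 0, phi 0 = X0 &
      forall t, J t ->
        is_derive t 1 (fun s => (phi s).1) (F (phi t)).1 /\
        is_derive t 1 (fun s => (phi s).2) (F (phi t)).2].

(* For a locally Lipschitz F, such as a polynomial field, J is the maximal
   interval of existence I(X0) and phi t is the flow Phi_t(X0) for t in J. *)
Definition is_maximal_solution (R : realType) (F : R * R -> R * R)
    (X0 : R * R) (J : set R) (phi : R -> R * R) : Prop :=
  is_solution F X0 J phi /\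
  forall (J' : set R) (psi : R -> R * R),
    is_solution F X0 J' psi -> J `<=` J' ->
    (forall t, J t -> psi t = phi t) -> J' = J.

Definition invariant_set (R : realType) (F : R * R -> R * R)
    (S : set (R * R)) : Prop :=
  forall (X0 : R * R) (J : set R) (phi : R -> R * R),
    S X0 -> is_maximal_solution F X0 J phi -> forall t, J t -> S (phi t).

Definition is_line (R : realType) (L : set (R * R)) : Prop :=
  exists p q r : R, (p, q) <> (0, 0) /\
    L = [set X | p * X.1 + q * X.2 = r].

Definition invariant_line (R : realType) (F : R * R -> R * R)
    (L : set (R * R)) : Prop :=
  is_line L /\ invariant_set F L.

Definition slope_line (R : realType) (m : R) : set (R * R) :=
  [set X | X.2 = m * X.1].

(* Main.v *)
(* Write P, Q for the components of the field.  On y = m x the polynomial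
   Q - m P becomes sum_k c_k x^k, where c_k is the left-hand side of the k-th
   equation in (2); so if every c_k vanishes then y - m x divides Q - m P, say
   Q - m P = G (y - m x).  Along a solution, w = y - m x then satisfies the
   linear equation w' = G w with w 0 = 0, and w = 0 by the usual uniqueness
   argument: where G <= K, the function w^2 exp (- 2 K t) is nonincreasing. *)
Require Import Defs.
From HB Require Import structures.
From mathcomp Require Import all_boot all_order all_algebra.
From mathcomp Require Import all_classical all_reals all_analysis.
From mathcomp Require Import ring.
Set Implicit Arguments.
Unset Strict Implicit.
Unset Printing Implicit Defensive.
Import Order.TTheory GRing.Theory Num.Theory.
Import numFieldNormedType.Exports.
Local Open Scope classical_set_scope.
Local Open Scope ring_scope.

Lemma linear_ode_eq0_forward (R : realType) (w g : R -> R) (K T : R) :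
  0 <= T ->
  (forall t : R, 0 <= t <= T -> is_derive t 1 w (g t * w t)) ->
  (forall t : R, 0 <= t <= T -> g t <= K) ->
  w 0 = 0 -> w T = 0.
Proof.
move=> T0 dw gK w0.
(* The exponential weight brings the factor [g t - K <= 0] into [u'], so [0 <= u T <= u 0 = 0]. *)
pose u := (w ^+ 2) * (expR \o ( *%R (- (2 * K)))).
have du t : 0 <= t <= T ->
    is_derive t 1 u (2 * (g t - K) * w t ^+ 2 * expR (- (2 * K) * t)).
  move=> tT; have dwt := dw t tT.
  have de : is_derive t 1 (expR \o ( *%R (- (2 * K))))
      (expR (- (2 * K) * t) * (- (2 * K) *: 1)).
    by apply: is_derive1_comp; exact: (is_deriveZ id).
  apply: is_derive_eq; rewrite /GRing.scale /=.
  rewrite !fctE; ring.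
have u_nonincr : {in `[0, T] &, {homo u : x y /~ x <= y}}.
  apply: ler0_derive1_le_cc => [t tT|t tT|].
  - have /du[]// : 0 <= t <= T by apply: subset_itv_oo_cc tT.
  - have tT' : 0 <= t <= T by apply: subset_itv_oo_cc tT.
    rewrite derive1E (@derive_val _ _ _ _ _ _ _ (du t tT')).
    rewrite -mulrA mulr_le0_ge0//; last exact: mulr_ge0 (sqr_ge0 _) (expR_ge0 _).
    by rewrite pmulr_rle0// subr_le0 gK.
  - apply: derivable_within_continuous => t.
    by rewrite in_itv/= => /du[].
have : u T <= u 0.
  by apply: u_nonincr; rewrite ?in_itv/= ?lexx ?T0.
have -> : u 0 = 0 by rewrite /u !fctE w0 expr0n/= mul0r.
rewrite /u !fctE/= pmulr_lle0 ?expR_gt0// => wT.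
by apply/eqP; rewrite -sqrf_eq0 eq_le wT sqr_ge0.
Qed.

Lemma linear_ode_eq0 (R : realType) (J : set R) (w g : R -> R) :
  is_interval J -> J 0 ->
  (forall t, J t -> {for t, continuous g}) ->
  (forall t, J t -> is_derive t 1 w (g t * w t)) ->
  w 0 = 0 -> forall t, J t -> w t = 0.
Proof.
suff forward (J' : set R) (w' g' : R -> R) T :
    is_interval J' -> J' 0 -> (forall t, J' t -> {for t, continuous g'}) ->
    (forall t, J' t -> is_derive t 1 w' (g' t * w' t)) ->
    w' 0 = 0 -> J' T -> 0 <= T -> w' T = 0.
  move=> iJ J0 cg dw w0 T JT; have [T0|T0] := leP 0 T.
    exact: (forward J w g).
  (* Time reversal: [w (- t)] solves the linear equation with coefficient [- g (- t)] on the
     reflected interval. *)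
  rewrite -[T]opprK.
  apply: (forward [set t | J (- t)] (w \o -%R) (fun t => - g (- t))) => //=.
  - move=> x y /= Jx Jy z /andP[xz zy].
    by apply: (iJ _ _ Jy Jx); rewrite !lerN2 zy xz.
  - by rewrite oppr0.
  - move=> t Jt; apply: cvgN; apply: cvg_comp; first exact: oppr_continuous.
    exact: cg.
  - move=> t Jt; have dwt := dw _ Jt.
    have dwN : is_derive t 1 (w \o -%R) (g (- t) * w (- t) * -1).
      exact: is_derive1_comp.
    by apply: is_derive_eq; rewrite /=; ring.
  - by rewrite oppr0.
  - by rewrite opprK.
  - by rewrite oppr_ge0 ltW.
move=> iJ J0 cg dw w0 JT T0.
have JI t : 0 <= t <= T -> J' t by move=> tT; apply: (iJ _ _ J0 JT).
(* The bound [K] is the maximum of the continuous [g'] on the compact segment from 0 to [T], which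
   lies in [J']. *)
have [|c _ gc] := @EVT_max _ g' 0 T T0.
  by apply: continuous_in_subspaceT => t /set_mem/=; rewrite in_itv/= => /JI/cg.
apply: (linear_ode_eq0_forward (K := g' c) (g := g')) => // t tT.
exact/dw/JI.
Qed.

(** Regrouping by total degree [k = i + j]: the part of the square outside the triangle [i + j <= n]
    contributes zero. *)
Lemma sum_antidiagonal (V : nmodType) (n : nat) (f : nat -> nat -> V) :
  (forall i j, (i <= n)%N -> (j <= n)%N -> (n < i + j)%N -> f i j = 0) ->
  \sum_(i < n.+1) \sum_(j < n.+1) f i j =
  \sum_(k < n.+1) \sum_(j < k.+1) f (k - j)%N j.
Proof.
move=> f0.
(* The inner range is made independent of [k], with a guard [j < k.+1], so that the two sums can be
   exchanged. *)
under [RHS]eq_bigr => k _ do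
  rewrite (big_ord_widen n.+1 (fun j => f (k - j)%N j)) ?ltn_ord//.
rewrite [LHS]exchange_big [RHS](exchange_big_dep predT)//=.
apply: eq_bigr => j _.
(* For fixed [j], the shift [k = i + j] makes the right side a sum over [i < n.+1 - j]; the left
   side is cut there. *)
rewrite -(big_mkord xpredT (fun i => f i j)).
rewrite -(big_mkord (fun k => (j < k.+1)%N) (fun k => f (k - j)%N j)).
rewrite -(@big_nat_widenl _ _ _ j 0 _ xpredT)// -{2}[j : nat]add0n big_addn.
under [RHS]eq_bigr do rewrite addnK.
rewrite [LHS](big_cat_nat (n := n.+1 - j)) ?leq_subr//=.
rewrite [X in _ + X]big_nat [X in _ + X]big1 ?addr0// => i /andP[ji i_n].
apply: f0 => //; first by rewrite -ltnS.
by rewrite addnC -leq_subLR.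
Qed.

(** This is c_k, kept in the shape of the equations in (2) so that they apply verbatim. *)
Definition line_coef (R : realType) (a b : nat -> nat -> R) (m : R) (k : nat) : R :=
  b k 0%N + \sum_(1 <= j < k.+1)
    (b (k - j)%N j - a (k - (j - 1))%N (j - 1)%N) * m ^+ j
  - a 0%N k * m ^+ k.+1.

(** The isolated terms are the missing ends of two sums: [b k 0] is the term [j = 0] of the [b]-sum,
    and [a 0 k] the term [j = k] of the [a]-sum, whose index is shifted by one. *)
Lemma line_coefE (R : realType) (a b : nat -> nat -> R) (m : R) (k : nat) :
  line_coef a b m k =
  \sum_(j < k.+1) (b (k - j)%N j - m * a (k - j)%N j) * m ^+ j.
Proof.
rewrite /line_coef big_add1 big_mkord /=.
under eq_bigr do rewrite subn1 /= mulrBl.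
under [RHS]eq_bigr do rewrite mulrBl.
rewrite !sumrB [\sum_(j < k.+1) b _ _ * _]big_ord_recl.
rewrite [\sum_(j < k.+1) m * _ * _]big_ord_recr /= subn0 subnn expr0 mulr1.
suff -> : \sum_(j < k) m * a (k - j)%N j * m ^+ j =
    \sum_(j < k) a (k - j)%N j * m ^+ j.+1 by rewrite exprS; ring.
by apply: eq_bigr => j _; rewrite exprS; ring.
Qed.

Lemma poly_field_on_line (R : realType) (n : nat) (a b : nat -> nat -> R) (m x : R) :
  (forall i j : nat, (i <= n)%N -> (j <= n)%N -> (n < i + j)%N ->
    a i j = 0 /\ b i j = 0) ->
  (forall k, (k <= n)%N -> line_coef a b m k = 0) ->
  poly2 n b x (m * x) = m * poly2 n a x (m * x).
Proof.
move=> hdeg c0; apply/eqP; rewrite -subr_eq0; apply/eqP.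
transitivity (\sum_(i < n.+1) \sum_(j < n.+1)
    (b i j - m * a i j) * m ^+ j * x ^+ (i + j)).
  rewrite /poly2 mulr_sumr -sumrB; apply: eq_bigr => i _.
  rewrite mulr_sumr -sumrB; apply: eq_bigr => j _.
  by rewrite exprMn exprD; ring.
rewrite (@sum_antidiagonal _ n
  (fun i j => (b i j - m * a i j) * m ^+ j * x ^+ (i + j))); last first.
  by move=> i j ni nj /(hdeg _ _ ni nj)[-> ->]; rewrite mulr0 subr0 !mul0r.
apply: big1 => k _; under eq_bigr => j _ do rewrite subnK -1?ltnS//.
by rewrite -mulr_suml -line_coefE c0 ?mul0r// -ltnS.
Qed.

(* The divided difference of [poly2 n c x] between [y] and [m * x]. *)
Definition poly2_cofactor (R : realType) (n : nat) (c : nat -> nat -> R) (m x y : R) : R :=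
  \sum_(i < n.+1) \sum_(j < n.+1)
    c i j * x ^+ i * \sum_(k < j) y ^+ (j.-1 - k) * (m * x) ^+ k.

(** Termwise factorization of [y ^+ j - (m * x) ^+ j]; for [j = 0] the inner sum is empty, so the
    truncated [j.-1] does no harm. *)
Lemma poly2_cofactorE (R : realType) (n : nat) (c : nat -> nat -> R) (m x y : R) :
  poly2 n c x y - poly2 n c x (m * x) = poly2_cofactor n c m x y * (y - m * x).
Proof.
rewrite /poly2 /poly2_cofactor -sumrB mulr_suml; apply: eq_bigr => i _.
rewrite -sumrB mulr_suml; apply: eq_bigr => j _.
by rewrite -mulrBr subrXX; ring.
Qed.

Lemma continuous_poly2_cofactor (R : realType) (n : nat) (c : nat -> nat -> R)
    (m t : R) (x y : R -> R) :
  {for t, continuous x} -> {for t, continuous y} ->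
  {for t, continuous (fun s => poly2_cofactor n c m (x s) (y s))}.
Proof.
move=> cx cy.
have cX (z : R -> R) k : {for t, continuous z} -> {for t, continuous (fun s => z s ^+ k)}.
  by move=> cz; exact: (@continuous_comp _ _ _ z (fun u => u ^+ k) _ cz
    (@exprn_continuous R k (z t))).
apply: cvg_big => [|i _]; first exact: (@add_continuous R).
apply: cvg_big => [|j _]; first exact: (@add_continuous R).
apply: cvgM; first by apply: cvgM; [exact: cvg_cst | exact: cX].
apply: cvg_big => [|k _]; first exact: (@add_continuous R).
apply: cvgM; first exact: cX.
by apply: (cX (fun s => m * x s)); apply: cvgM => //; exact: cvg_cst.
Qed.

Lemma invariant_slope_line (R : realType) (n : nat) (a b : nat -> nat -> R) (m : R) :
  (forall x, poly2 n b x (m * x) = m * poly2 n a x (m * x)) ->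
  invariant_line (poly_field n a b) (slope_line m).
Proof.
move=> hm; split.
  exists m, (-1), 0; split; first by case=> _ /eqP; rewrite oppr_eq0 oner_eq0.
  apply/seteqP; split=> -[x y] /=; rewrite /slope_line /= mulN1r.
    by move=> ->; rewrite subrr.
  by move/eqP; rewrite subr_eq0 => /eqP.
move=> X0 J phi X0m [[iJ oJ J0 phi0 dphi] _] t Jt; rewrite /slope_line /=.
pose x s := (phi s).1; pose y s := (phi s).2.
have contx s : J s -> {for s, continuous x}.
  by move=> /dphi[[dx _] _]; apply/differentiable_continuous/derivable1_diffP.
have conty s : J s -> {for s, continuous y}.
  by move=> /dphi[_ [dy _]]; apply/differentiable_continuous/derivable1_diffP.
(* The factor G along the solution. By [hm] the values of Q and m P on the line cancel, so Q - m P
   is the difference of the two cofactor identities. *)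
pose g s := poly2_cofactor n b m (x s) (y s)
            - m * poly2_cofactor n a m (x s) (y s).
suff /eqP : (y - m \*: x) t = 0 by rewrite !fctE subr_eq0 => /eqP.
apply: (@linear_ode_eq0 _ J _ g) Jt => //.
- move=> s Js; apply: cvgB; last apply: cvgM; first last.
  + exact: continuous_poly2_cofactor (contx s Js) (conty s Js).
  + exact: cvg_cst.
  + exact: continuous_poly2_cofactor (contx s Js) (conty s Js).
- move=> s Js; have [dx dy] := dphi s Js.
  apply: (is_derive_eq (is_deriveB dy (is_deriveZ m dx))).
  rewrite /g !fctE /GRing.scale /= mulrBl -mulrA -!poly2_cofactorE hm /x /y; ring.
- rewrite !fctE /x /y /= phi0 /GRing.scale /=.
  by apply/eqP; rewrite subr_eq0; apply/eqP.
Qed.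

(** Every term vanishes whatever [m] is, which is why (1) yields all slopes. *)
Lemma line_coef_eq0 (R : realType) (a b : nat -> nat -> R) (m : R) (k : nat) :
  b k 0%N = 0 /\ a 0%N k = 0 /\
    (forall j, (1 <= j <= k)%N ->
      b (k - j)%N j - a (k - (j - 1))%N (j - 1)%N = 0) ->
  line_coef a b m k = 0.
Proof.
move=> [bk [ak h]]; rewrite /line_coef bk ak add0r mul0r subr0.
by rewrite big_nat; apply: big1 => j /h ->; rewrite mul0r.
Qed.

Lemma slope_line_inj (R : realType) : injective (@slope_line R).
Proof.
move=> m m' mm'.
(* The point of abscissa 1 recovers the slope. *)
have : slope_line m (1, m) by rewrite /slope_line /= mulr1.
by rewrite mm' /slope_line /= mulr1.
Qed.

Lemma infinite_setT_realType (R : realType) : infinite_set [set: R].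
Proof.
move=> fR; apply: infinite_nat.
have : finite_set ((fun k : nat => k%:R : R) @^-1` setT).
  by apply: finite_preimage fR => k l _ _ /eqP; rewrite eqr_nat => /eqP.
by rewrite preimage_setT.
Qed.

Theorem theorem3p2 (R : realType) (n : nat) (hn : (1 <= n)%N)
    (a b : nat -> nat -> R)
    (ha0 : a 0%N 0%N = 0) (hb0 : b 0%N 0%N = 0)
    (hdeg : forall i j : nat, (i <= n)%N -> (j <= n)%N -> (n < i + j)%N ->
      a i j = 0 /\ b i j = 0) :
  ((forall k : nat, (1 <= k <= n)%N ->
      b k 0%N = 0 /\ a 0%N k = 0 /\
      forall j : nat, (1 <= j <= k)%N ->
        b (k - j)%N j - a (k - (j - 1))%N (j - 1)%N = 0) ->
    infinite_set [set L : set (R * R) |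
      exists m : R, L = slope_line m /\ invariant_line (poly_field n a b) L])
  /\
  (forall (l : nat) (i : 'I_l -> nat),
    (1 <= l <= n)%N ->
    injective i ->
    (forall p : 'I_l, (1 <= i p <= n)%N) ->
    (forall k : nat, (1 <= k <= n)%N -> (forall p : 'I_l, k <> i p) ->
      b k 0%N = 0 /\ a 0%N k = 0 /\
      forall j : nat, (1 <= j <= k)%N ->
        b (k - j)%N j - a (k - (j - 1))%N (j - 1)%N = 0) ->
    forall m : R,
      (forall p : 'I_l,
        b (i p) 0%N
        + \sum_(1 <= j < (i p).+1)
            (b (i p - j)%N j - a (i p - (j - 1))%N (j - 1)%N) * m ^+ j
        - a 0%N (i p) * m ^+ (i p).+1 = 0) ->
      invariant_line (poly_field n a b) (slope_line m)).
Proof.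
(* Degree 0 lies outside the range [1 <= k] of the coefficient conditions; it is settled by the
   vanishing constant terms. *)
have c0 m : line_coef a b m 0 = 0.
  by rewrite /line_coef ha0 hb0 big_geq// mul0r addr0 subr0.
split=> [h|l i _ _ _ h m hm]; last first.
  apply: invariant_slope_line => x; apply: poly_field_on_line hdeg _ => -[//|k] kn.
  (* In a degree [i p] the chosen [m] is a root; in any other degree the coefficient conditions
     hold. *)
  have [[p ->]|kp] := pselect (exists p, k.+1 = i p); first exact: hm.
  by apply/line_coef_eq0/h => // p kip; apply: kp; exists p.
(* If the set of lines were finite, its preimage under the injective [slope_line], which is all of
   [R], would be finite too. *)
suff inv m : invariant_line (poly_field n a b) (slope_line m).
  move=> finL; apply: (@infinite_setT_realType R).
  rewrite -(preimage_setT (@slope_line R)).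
  have -> : @slope_line R @^-1` setT = @slope_line R @^-1` [set L : set (R * R) |
      exists m : R, L = slope_line m /\ invariant_line (poly_field n a b) L].
    by apply/seteqP; split=> // m _; exists m.
  by apply: finite_preimage finL => ? ? _ _; exact: slope_line_inj.
apply: invariant_slope_line => x; apply: poly_field_on_line hdeg _ => -[//|k] kn.
exact/line_coef_eq0/h.
Qed.
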